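(* Let $(V,\nu)$ be a fuzzy antinormed linear space with respect to a t-conorm $\diamond$, and assume that (a) for every $x\in V$, if $\nu(x,t)<1$ for all $t>0$ then $x=\theta$; and (b) $a\diamond a=a$ for all $a\in[0,1]$. Let $\alpha\in(0,1)$. Then the fuzzy $\alpha$-antilimit of a fuzzy $\alpha$-anti-convergent sequence in $(V,\nu)$ is unique.
   Context: $V$ is a linear space over $F$ ($F=\mathbb{R}$ or $\mathbb{C}$), and $\theta$ is its zero vector. A t-conorm is a map $\diamond:[0,1]\times[0,1]\to[0,1]$ that is commutative, associative, continuous, satisfies $a\diamond 0=a$ for all $a$, and satisfies $a\diamond b\le c\diamond d$ whenever $a\le c$, $b\le d$. A fuzzy antinorm on $V$ with respect to $\diamond$ is a function $\nu:V\times\mathbb{R}\to[0,1]$ such that for all $x,y\in V$: (i) $\nu(x,t)=1$ for all $t\le 0$; (ii) $\nu(x,t)=0$ for all $t>0$ if and only if $x=\theta$; (iii) $\nu(cx,t)=\nu(x,t/|c|)$ for all $t>0$ and $c\in F$, $c\ne 0$; (iv) $\nu(x+y,s+t)\le\nu(x,s)\diamond\nu(y,t)$ for all $s,t\in\mathbb{R}$; (v) $\lim_{t\to\infty}\nu(x,t)=0$. The pair $(V,\nu)$ is then called a fuzzy antinormed linear space with respect to $\diamond$. For $\alpha\in(0,1)$, a sequence $(x_n)$ in $V$ is fuzzy $\alpha$-anti-convergent if there exists $x\in V$ such that $\lim_{n\to\infty}\nu(x_n-x,t)<1-\alpha$ for all $t>0$; such an $x$ is called a fuzzy $\alpha$-antilimit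 of $(x_n)$. *)

(* Defs.v *)
From Stdlib Require Import Reals.
From Coquelicot Require Import Coquelicot.

Open Scope R_scope.

Variant scalar_field := RealScalars | ComplexScalars.

Definition scalars (k : scalar_field) : AbsRing :=
  match k with
  | RealScalars => R_AbsRing
  | ComplexScalars => C_AbsRing
  end.

Definition unit_interval (a : R) : Prop := 0 <= a <= 1.

Definition unit_square (p : R * R) : Prop :=
  unit_interval (fst p) /\ unit_interval (snd p).

(* A map [0,1] x [0,1] -> [0,1] is represented by a function R -> R -> R, of
   which only the values on the unit square are constrained; in particular
   continuity is relative to the unit square. *)
Record t_conorm (d : R -> R -> R) : Prop := {
  tc_range : forall a b, unit_interval a -> unit_interval b ->
    unit_interval (d a b);
  tc_comm : forall a b, unit_interval a -> unit_interval b ->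
    d a b = d b a;
  tc_assoc : forall a b c,
    unit_interval a -> unit_interval b -> unit_interval c ->
    d a (d b c) = d (d a b) c;
  tc_continuous : continuous_on unit_square (fun p : R * R => d (fst p) (snd p));
  tc_zero : forall a, unit_interval a -> d a 0 = a;
  tc_mono : forall a b c e,
    unit_interval a -> unit_interval b -> unit_interval c -> unit_interval e ->
    a <= c -> b <= e -> d a b <= d c e
}.

Record fuzzy_antinorm {k : scalar_field} {V : ModuleSpace (scalars k)}
    (d : R -> R -> R) (nu : V -> R -> R) : Prop := {
  fa_range : forall x t, unit_interval (nu x t);
  fa_nonpos : forall x t, t <= 0 -> nu x t = 1;
  fa_zero : forall x, (forall t, 0 < t -> nu x t = 0) <-> x = zero;
  fa_scal : forall (x : V) (c : scalars k) t, 0 < t -> c <> zero ->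
    nu (scal c x) t = nu x (t / abs c);
  fa_plus : forall x y s t, nu (plus x y) (s + t) <= d (nu x s) (nu y t);
  fa_lim : forall x, is_lim (nu x) p_infty 0
}.

Definition fuzzy_antilimit {k : scalar_field} {V : ModuleSpace (scalars k)}
    (nu : V -> R -> R) (alpha : R) (u : nat -> V) (x : V) : Prop :=
  forall t, 0 < t ->
    exists l : R, is_lim_seq (fun n => nu (minus (u n) x) t) l /\ l < 1 - alpha.

Definition fuzzy_anti_convergent {k : scalar_field}
    {V : ModuleSpace (scalars k)}
    (nu : V -> R -> R) (alpha : R) (u : nat -> V) : Prop :=
  exists x : V, fuzzy_antilimit nu alpha u x.

(* Main.v *)
Require Import Defs.
From Stdlib Require Import Reals Lra.
From Coquelicot Require Import Coquelicot.

(** If [x] and [y] are both antilimits of [u], then for [n] large the vectors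
    [u n - x] and [u n - y] both have antinorm below [1 - alpha] at [t / 2].
    Their difference is [y - x], so [nu (y - x) t] is at most the t-conorm of
    two numbers below [1 - alpha], and an idempotent t-conorm cannot push these
    above [1 - alpha]: it is dominated by the maximum
    ([idempotent_t_conorm_le]). Hence [nu (y - x) t < 1] for every [t > 0], and
    hypothesis [Ha] forces [y - x] to vanish. *)

(** Monotonicity compares [d a b] with [d m m]; idempotence evaluates the
    latter. *)
Lemma idempotent_t_conorm_le (d : R -> R -> R) (Hd : t_conorm d)
    (Hb : forall a : R, unit_interval a -> d a a = a) (a b m : R) :
  unit_interval a -> unit_interval b -> unit_interval m ->
  a <= m -> b <= m -> d a b <= m.
Proof.
  intros Ia Ib Im Ham Hbm.
  rewrite <- (Hb m Im).
  now apply (tc_mono d Hd).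
Qed.

Lemma fuzzy_antinorm_opp (k : scalar_field) (V : ModuleSpace (scalars k))
    (d : R -> R -> R) (nu : V -> R -> R) (Hnu : fuzzy_antinorm d nu)
    (x : V) (t : R) :
  0 < t -> nu (opp x) t = nu x t.
Proof.
  intros Ht.
  rewrite <- (scal_opp_one x).
  rewrite (fa_scal d nu Hnu) by
    (try exact Ht; intros E; generalize (abs_opp_one (K := scalars k));
     rewrite E, abs_zero; lra).
  now rewrite abs_opp_one, Rdiv_1_r.
Qed.

(** Since the limit is strictly below [1 - alpha], the open half-line below
    [1 - alpha] is a neighbourhood of it. *)
Lemma fuzzy_antilimit_eventually (k : scalar_field)
    (V : ModuleSpace (scalars k)) (nu : V -> R -> R) (alpha : R)
    (u : nat -> V) (x : V) (t : R) :
  fuzzy_antilimit nu alpha u x -> 0 < t ->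
  eventually (fun n => nu (minus (u n) x) t < 1 - alpha).
Proof.
  intros Hx Ht.
  destruct (Hx t Ht) as [l [Hl Hlt]].
  exact (Hl (fun v => v < 1 - alpha) (open_lt (1 - alpha) l Hlt)).
Qed.

Lemma fuzzy_antilimit_diff_le (k : scalar_field)
    (V : ModuleSpace (scalars k)) (d : R -> R -> R) (nu : V -> R -> R)
    (Hd : t_conorm d) (Hnu : fuzzy_antinorm d nu)
    (Hb : forall a : R, unit_interval a -> d a a = a)
    (alpha : R) (Halpha : 0 < alpha < 1) (u : nat -> V) (x y : V) (t : R) :
  fuzzy_antilimit nu alpha u x -> fuzzy_antilimit nu alpha u y -> 0 < t ->
  nu (minus y x) t <= 1 - alpha.
Proof.
  intros Hx Hy Ht.
  assert (Ht2 : 0 < t / 2) by lra.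
  destruct (fuzzy_antilimit_eventually _ _ _ _ _ _ _ Hx Ht2) as [N1 H1].
  destruct (fuzzy_antilimit_eventually _ _ _ _ _ _ _ Hy Ht2) as [N2 H2].
  set (n := max N1 N2).
  specialize (H1 n (Nat.le_max_l _ _)).
  specialize (H2 n (Nat.le_max_r _ _)).
  rewrite <- (fuzzy_antinorm_opp k V d nu Hnu _ _ Ht2), opp_minus in H2.
  rewrite (minus_trans (u n) y x).
  replace t with (t / 2 + t / 2) by lra.
  eapply Rle_trans; [apply (fa_plus d nu Hnu)|].
  apply idempotent_t_conorm_le; auto; try apply (fa_range d nu Hnu);
    try apply Rlt_le; auto.
  unfold unit_interval; lra.
Qed.

Theorem theorem4p3 (k : scalar_field) (V : ModuleSpace (scalars k))
    (d : R -> R -> R) (nu : V -> R -> R)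
    (Hd : t_conorm d) (Hnu : fuzzy_antinorm d nu)
    (Ha : forall x : V, (forall t : R, (0 < t)%R -> (nu x t < 1)%R) -> x = zero)
    (Hb : forall a : R, unit_interval a -> d a a = a)
    (alpha : R) (Halpha : (0 < alpha < 1)%R)
    (u : nat -> V) (Hu : fuzzy_anti_convergent nu alpha u) :
  exists! x : V, fuzzy_antilimit nu alpha u x.
Proof.
  destruct Hu as [x Hx].
  exists x; split; [exact Hx|].
  intros y Hy.
  assert (Hyx : minus y x = zero).
  { apply Ha; intros t Ht.
    apply Rle_lt_trans with (1 - alpha); [|lra].
    now apply (fuzzy_antilimit_diff_le k V d nu Hd Hnu Hb alpha Halpha u). }
  apply (plus_reg_r (opp x)).
  rewrite plus_opp_r.
  symmetry; exact Hyx.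
Qed.
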